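(* There exists a $4$-dimensional real Banach space $X$ satisfying the following conditions: (A) $X$ is a direct sum $X=Y_1\oplus Y_2$ of two $2$-dimensional Euclidean subspaces $Y_1$ and $Y_2$ (that is, the norm of $X$ restricted to each $Y_j$ is Euclidean), with both direct sum projections having norm $1$. (B) There exists $\varepsilon>0$ such that for any $(r,R)$ satisfying $0<r<R<\infty$ and any linear isometric embeddings $I_1:\ell_2^2\to Y_1$ and $I_2:\ell_2^2\to Y_2$, there is no $(1+\varepsilon)$-bending with parameters $(r,R)$ of $\ell_2^2$ in $X$ from $I_1$ to $I_2$.
   Context: For a direct sum $X=Y_1\oplus Y_2$, the direct sum projections are $P_1(y_1+y_2)=y_1$ and $P_2(y_1+y_2)=y_2$ ($y_j\in Y_j$). Let $X$ and $Y$ be Banach spaces and $I_1,I_2:Y\to X$ linear isometric embeddings with distinct images. For $C\in[1,\infty)$ and $0<r<R<\infty$, a map $T:Y\to X$ is called a $C$-bending of $Y$ in $X$ from $I_1$ to $I_2$ with parameters $(r,R)$ if it is a bilipschitz embedding with distortion $\mathrm{Lip}(T)\cdot\mathrm{Lip}(T^{-1}|_{T(Y)})\le C$ such that the restriction of $T$ to the ball $\{\|y\|\le r\}$ of $Y$ coincides with $I_1$ and the restriction of $T$ to the exterior $\{\|y\|\ge R\}$ of the ball of radius $R$ in $Y$ coincides with $I_2$. *)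

(* Defs.v *)
From HB Require Import structures.
From mathcomp Require Import all_boot all_order all_algebra.
From mathcomp Require Import sesquilinear ring.
From mathcomp Require Import all_classical all_reals all_analysis.

Set Implicit Arguments.
Unset Strict Implicit.
Unset Printing Implicit Defensive.

Import Order.TTheory GRing.Theory Num.Theory.
Import numFieldNormedType.Exports.

Local Open Scope classical_set_scope.
Local Open Scope ring_scope.

#[short(type="finBanachType")]
HB.structure Definition FinBanach (K : numFieldType) :=
  {V of CompleteNormedModule K V & Vector K V}.

(* The space $\ell_2^n$: an alias of 'rV[R]_n, needed because the canonical
   norm of 'rV[R]_n is the sup norm. *)
Definition l2 (R : realType) (n : nat) : Type := 'rV[R]_n.

Section l2_instances.
Variables (R : realType) (n : nat).

HB.instance Definition _ := Vector.copy (l2 R n) 'rV[R]_n.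

Definition l2norm (x : l2 R n) : R :=
  Num.sqrt (\sum_(i < n) (x : 'rV[R]_n) ord0 i ^+ 2).

Let co (x : l2 R n) (i : 'I_n) : R := (x : 'rV[R]_n) ord0 i.

Let sumsq_ge0 (f : 'I_n -> R) : 0 <= \sum_(i < n) f i ^+ 2.
Proof. by apply: sumr_ge0 => i _; exact: sqr_ge0. Qed.

Let coD x y i : co (x + y) i = co x i + co y i.
Proof. exact: mxE. Qed.

Let coB x y i : co (x - y) i = co x i - co y i.
Proof. by rewrite coD; congr (_ + _); exact: mxE. Qed.

Let cauchy_schwarz (f g : 'I_n -> R) :
  (\sum_i f i * g i) ^+ 2 <= (\sum_i f i ^+ 2) * (\sum_i g i ^+ 2).
Proof.
have : 0 <= \sum_i \sum_j (f i * g j - f j * g i) ^+ 2.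
  by apply: sumr_ge0 => i _; exact: sumsq_ge0.
have -> : \sum_i \sum_j (f i * g j - f j * g i) ^+ 2 =
    ((\sum_i f i ^+ 2) * (\sum_i g i ^+ 2)) *+ 2 - (\sum_i f i * g i) ^+ 2 *+ 2.
  rewrite expr2 !mulr_suml -!sumrMnl -sumrB.
  under [RHS]eq_bigr do rewrite !mulr_sumr -!sumrMnl -sumrB.
  have -> : \sum_i \sum_j (f i * g j - f j * g i) ^+ 2 =
     \sum_i \sum_j ((f i ^+ 2 * g j ^+ 2) *+ 2 - (f i * g i * (f j * g j)) *+ 2)
     + \sum_i \sum_j (f j ^+ 2 * g i ^+ 2 - f i ^+ 2 * g j ^+ 2).
    rewrite -big_split; apply: eq_bigr => i _; rewrite -big_split.
    by apply: eq_bigr => j _ /=; ring.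
  rewrite [X in _ + X](_ : _ = 0) ?addr0//.
  under eq_bigr do rewrite sumrB.
  by rewrite sumrB [X in X - _]exchange_big subrr.
by rewrite -mulrnBl pmulrn_lge0// subr_ge0.
Qed.

Let l2normD x y : l2norm (x + y) <= l2norm x + l2norm y.
Proof.
have sx : 0 <= l2norm x := sqrtr_ge0 _.
have sy : 0 <= l2norm y := sqrtr_ge0 _.
rewrite -(@ler_pXn2r _ 2) ?nnegrE ?addr_ge0 ?sqrtr_ge0// sqrrD !sqr_sqrtr//.
have -> : \sum_i (x + y : 'rV[R]_n) ord0 i ^+ 2 =
    \sum_i co x i ^+ 2 + (\sum_i co x i * co y i) *+ 2 + \sum_i co y i ^+ 2.
  rewrite -sumrMnl -!big_split; apply: eq_bigr => i _ /=.
  by rewrite -sqrrD -coD.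
rewrite lerD2r lerD2l lerMn2r/= -sqrtrM//.
by rewrite (le_trans (ler_norm _))// -sqrtr_sqr ler_sqrt ?mulr_ge0.
Qed.

Let l2normZ (k : R) x : l2norm (k *: x) = `|k| * l2norm x.
Proof.
rewrite -sqrtr_sqr -sqrtrM ?sqr_ge0// mulr_sumr; congr Num.sqrt.
by apply: eq_bigr => i _; rewrite -exprMn; congr (_ ^+ 2); exact: mxE.
Qed.

Let le_co_l2norm x i : `|co x i| <= l2norm x.
Proof.
rewrite -sqrtr_sqr ler_sqrt// (bigD1 i)//= lerDl sumr_ge0// => j _.
exact: sqr_ge0.
Qed.

Let l2norm_eq0 x : l2norm x = 0 -> x = 0.
Proof.
move=> x0; apply/rowP => i; have := le_co_l2norm x i.
by rewrite x0 normr_le0 => /eqP; rewrite /co => ->; rewrite mxE.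
Qed.

HB.instance Definition _ :=
  Lmodule_isNormed.Build R (l2 R n) l2normD l2normZ l2norm_eq0.

Let l2norm_le_sum x : l2norm x <= \sum_i `|co x i|.
Proof.
have s0 : 0 <= \sum_i `|co x i| by apply: sumr_ge0.
rewrite -[leRHS]ger0_norm// -sqrtr_sqr ler_sqrt ?sqr_ge0//.
rewrite expr2 mulr_suml; apply: ler_sum => i _.
rewrite -/(co x i) -real_normK ?num_real// expr2 ler_wpM2l//.
by rewrite (bigD1 i)//= lerDl sumr_ge0.
Qed.

Let l2_complete (F : set_system (l2 R n)) :
  ProperFilter F -> cauchy F -> cvg F.
Proof.
move=> FF /cauchyP Fc.
have cF i : cvg (co^~ i @ F).
  apply: cauchy_cvg; apply/cauchyP => e e0.
  have [x Fx] := Fc _ e0; exists (co x i).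
  rewrite /fmap /=; move: Fx; apply: filterS => y.
  rewrite -!ball_normE /= -coB; exact/le_lt_trans/le_co_l2norm.
pose l : l2 R n := \row_i lim (co^~ i @ F).
apply/cvg_ex; exists l; apply/cvgrPdist_le => e e0.
have d0 : 0 < e / n.+1%:R by rewrite divr_gt0.
have : \forall x \near F, forall i, `|co l i - co x i| <= e / n.+1%:R.
  apply: filter_forall => i.
  move/cvgrPdist_le: (cF i) => /(_ _ d0).
  by apply: filterS => x; rewrite /co /l mxE.
apply: filterS => x lx; apply: le_trans (l2norm_le_sum _) _.
under eq_bigr do rewrite coB.
apply: (@le_trans _ _ (\sum_(i < n) e / n.+1%:R)); first exact: ler_sum.
rewrite sumr_const card_ord -[leLHS]mulr_natr -mulrA ler_piMr ?ltW//.
by rewrite mulrC ltr_pdivrMr// mul1r ltr_nat.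
Qed.

HB.instance Definition _ := Uniform_isComplete.Build (l2 R n) l2_complete.

End l2_instances.

Lemma l2_normE (R : realType) (n : nat) (x : l2 R n) :
  `|x| = Num.sqrt (\sum_(i < n) (x : 'rV[R]_n) ord0 i ^+ 2).
Proof. by []. Qed.

Definition euclidean_subspace (R : realType) (X : finBanachType R)
    (V : {vspace X}) : Prop :=
  exists dot : {dot (subvs_of V) for (idfun : R -> R)},
    forall u : subvs_of V, `|vsval u| ^+ 2 = dot u u.

Definition isometric_embedding (R : realType) (Y X : normedModType R)
    (f : {linear Y -> X}) : Prop :=
  forall y, `|f y| = `|y|.

Definition opnorm (R : realType) (Y X : normedModType R) (f : Y -> X) :
    \bar R :=
  ereal_sup [set (`|f x|)%:E | x in [set x : Y | `|x| <= 1]].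

(* The least Lipschitz constant of f on A, +oo if f is not Lipschitz on A. *)
Definition Lip (R : realType) (Y X : normedModType R) (A : set Y)
    (f : Y -> X) : \bar R :=
  ereal_inf [set k%:E | k in [set k : R | 0 <= k /\ k.-lipschitz_A f]].

(* S ranges over the extensions to X of T^-1 : T(Y) -> Y; the values of S
   outside of T(Y) are irrelevant. *)
Definition bilipschitz_distortion_le (R : realType) (Y X : normedModType R)
    (T : Y -> X) (C : R) : Prop :=
  exists S : X -> Y, [/\ cancel T S,
    (Lip setT T < +oo)%E, (Lip (range T) S < +oo)%E
    & (Lip setT T * Lip (range T) S <= C%:E)%E].

Definition bending (R : realType) (Y X : completeNormedModType R)
    (C r rho : R) (I1 I2 : {linear Y -> X}) (T : Y -> X) : Prop :=
  [/\ bilipschitz_distortion_le T C,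
    (forall y, `|y| <= r -> T y = I1 y)
    & (forall y, rho <= `|y| -> T y = I2 y)].

(* Main.v *)
Require Import Defs.
From HB Require Import structures.
From mathcomp Require Import all_boot all_order all_algebra.
From mathcomp Require Import sesquilinear ring lra.
From mathcomp Require Import all_classical all_reals all_analysis.

Set Implicit Arguments.
Unset Strict Implicit.
Unset Printing Implicit Defensive.

Import Order.TTheory GRing.Theory Num.Theory.
Import numFieldNormedType.Exports.

Local Open Scope classical_set_scope.
Local Open Scope ring_scope.

(* Pairs (a, b) of vectors of R^n are normed by
     |(a, b)|^2 = |a|^2 + |b|^2 + n^-1 sum_ij |a_i| |b_j|;
   the theorem takes n = 2. This norm is strongly convex, so that a map T which
   is bilipschitz with constants close to 1 is almost affine on every segment,
   relative to its length. After rescaling, T is thus close on the unit ball to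
   a linear near-isometry L.
   Since Euclidean norms satisfy the parallelogram law, the second differences
   of the squared norm are O(t^2) in directions t * L e. The term |a_i| |b_j|
   instead has second differences of order t where a_i = 0 and b_j is not small.
   This forces the range of L to stay close to one of the two summands. But in a
   bending the ratio |P_1 (T (s e))| / s goes continuously from 1 to 0, hence is
   1/2 at some scale s. *)

(** * Real inequalities *)

Section real_inequalities.
Variable R : realFieldType.
Implicit Types a b x y z l : R.

Lemma sqr_le_conv l x y z : 0 <= l <= 1 -> 0 <= z -> z <= (1 - l) * x + l * y ->
  z ^+ 2 <= (1 - l) * x ^+ 2 + l * y ^+ 2.
Proof.
move=> /andP[l0 l1] z0 zle.
have sqr_conv : ((1 - l) * x + l * y) ^+ 2 <= (1 - l) * x ^+ 2 + l * y ^+ 2.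
  have := mulr_ge0 (mulr_ge0 l0 (_ : 0 <= 1 - l)) (sqr_ge0 (x - y)).
  by rewrite subr_ge0 => /(_ l1); nra.
by apply: le_trans sqr_conv; rewrite lerXn2r ?nnegrE// (le_trans z0).
Qed.

Lemma normr_conv_le l x y : 0 <= l <= 1 ->
  `|(1 - l) * x + l * y| <= (1 - l) * `|x| + l * `|y|.
Proof.
move=> /andP[l0 l1]; apply: le_trans (ler_normD _ _) _.
by rewrite !normrM (ger0_norm l0) ger0_norm ?subr_ge0.
Qed.

Lemma normrM_second_difference a b x y :
  - (2 * (`|x| * `|y|)) <=
  `|a + x| * `|b + y| + `|a - x| * `|b - y| - 2 * (`|a| * `|b|).
Proof.
rewrite -!normrM; have := ler_normD ((a + x) * (b + y)) ((a - x) * (b - y)).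
rewrite (_ : _ + _ = 2 * (a * b + x * y)); last by ring.
rewrite [X in X <= _]normrM ger0_norm//.
have := lerB_normD (a * b) (x * y); lra.
Qed.

Lemma normrM_kink a b x y :
  2 * (`|x| * `|b|) - 4 * (`|a| * `|b|) <=
  `|a + x| * `|b + y| + `|a - x| * `|b - y| - 2 * (`|a| * `|b|).
Proof.
have addx : `|x| - `|a| <= `|a + x| by rewrite (addrC a) lerB_normD.
have subx : `|x| - `|a| <= `|a - x| by rewrite distrC lerB_dist.
have bmid : 2 * `|b| <= `|b + y| + `|b - y|.
  have := ler_normD (b + y) (b - y).
  by rewrite (_ : _ + _ = 2 * b); [rewrite normrM ger0_norm|ring].
suff : (`|x| - `|a|) * (2 * `|b|) <= `|a + x| * `|b + y| + `|a - x| * `|b - y|.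
  lra.
have [xa|xa] := leP 0 (`|x| - `|a|); last first.
  apply: (@le_trans _ _ 0); last by rewrite addr_ge0// mulr_ge0.
  by rewrite mulr_le0_ge0 ?mulr_ge0// ltW.
apply: le_trans (ler_wpM2l xa bmid) _.
by rewrite mulrDr lerD// ler_wpM2r.
Qed.

Lemma normr_ge_sqr x z : 0 <= z -> z ^+ 2 <= x ^+ 2 -> z <= `|x|.
Proof.
by move=> z0 zx; rewrite -(@ler_pXn2r _ 2) ?nnegrE// real_normK ?num_real.
Qed.

Lemma natVM_le1 (n : nat) : n%:R^-1 * n%:R <= 1 :> R.
Proof. by case: n => [|n]; [rewrite mulr0|rewrite mulVf ?pnatr_eq0]. Qed.

End real_inequalities.

Lemma sqrt_subadditive (R : rcfType) (V : lmodType R) (q : V -> R) :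
  (forall x, 0 <= q x) -> (forall x, q x = 0 -> x = 0) ->
  (forall k x, q (k *: x) = k ^+ 2 * q x) ->
  (forall l x y, 0 <= l <= 1 ->
    q ((1 - l) *: x + l *: y) <= (1 - l) * q x + l * q y) ->
  forall x y, Num.sqrt (q (x + y)) <= Num.sqrt (q x) + Num.sqrt (q y).
Proof.
move=> q_ge0 q_eq0 qZ q_convex x y.
have sqrt_gt0 z : z != 0 -> 0 < Num.sqrt (q z).
  move=> z0; rewrite sqrtr_gt0 lt_def q_ge0 andbT.
  by apply: contra_neq z0 => /q_eq0.
have [->|x0] := eqVneq x 0; first by rewrite add0r lerDr sqrtr_ge0.
have [->|y0] := eqVneq y 0; first by rewrite addr0 lerDl sqrtr_ge0.
move: (sqrt_gt0 _ x0) (sqrt_gt0 _ y0).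
set a := Num.sqrt (q x); set b := Num.sqrt (q y) => a0 b0.
have [qxE qyE] : q x = a ^+ 2 /\ q y = b ^+ 2 by rewrite /a /b !sqr_sqrtr.
have ab0 : 0 < a + b by rewrite addr_gt0.
pose l := b / (a + b).
have l1E : 1 - l = a / (a + b) by rewrite /l; field; rewrite gt_eqF.
have [l0 l1] : 0 < l /\ 0 < 1 - l by rewrite l1E !divr_gt0.
have l01 : 0 <= l <= 1 by lra.
rewrite -(@ler_pXn2r _ 2) ?nnegrE ?sqrtr_ge0 ?(ltW ab0)// sqr_sqrtr//.
have := q_convex l ((1 - l)^-1 *: x) (l^-1 *: y) l01.
rewrite !scalerA !divff ?gt_eqF// !scale1r !qZ qxE qyE => /le_trans; apply.
rewrite [leLHS](_ : _ = (a + b) ^+ 2)// l1E /l; field.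
by rewrite !gt_eqF.
Qed.

(** * Normed and finite-dimensional spaces *)

Lemma klipschitz_continuous (R : realType) (X Y : normedModType R) (k : R)
    (f : X -> Y) :
  (forall x y, `|f x - f y| <= k * `|x - y|) -> continuous f.
Proof.
move=> fk x; apply/cvgrPdist_le => e e0.
have k1 : 0 < `|k| + 1 by rewrite ltr_wpDl.
near=> y; apply: (@le_trans _ _ ((`|k| + 1) * `|x - y|)).
  apply: le_trans (fk _ _) _; rewrite ler_wpM2r// (le_trans (ler_norm k))//.
  by rewrite lerDl.
rewrite mulrC -ler_pdivlMr//; near: y.
by apply: cvgr_dist_le; rewrite ?divr_gt0.
Unshelve. all: by end_near.
Qed.

Lemma cvg_fmap_nonexpansive (R : realType) (X : normedModType R)
    (Y : completeNormedModType R) (f : X -> Y) (F : set_system X) :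
  ProperFilter F -> cauchy F -> (forall x y, `|f x - f y| <= `|x - y|) ->
  cvg (f @ F).
Proof.
move=> FF /cauchyP F_cauchy f1; apply: cauchy_cvg; apply/cauchyP => e e0.
have [x Fx] := F_cauchy _ e0; exists (f x).
rewrite /fmap /=; move: Fx; apply: filterS => y.
rewrite -!ball_normE /=; exact/le_lt_trans/f1.
Qed.

Lemma opnorm_eq1 (R : realType) (X Y : normedModType R) (f : X -> Y) (e : X) :
  (forall x, `|f x| <= `|x|) -> `|e| = 1 -> `|f e| = 1 -> opnorm f = 1%E.
Proof.
move=> f_le e1 fe1; apply/eqP; rewrite eq_le; apply/andP; split.
  apply: ge_ereal_sup => _ [x /= x1 <-].
  by rewrite lee_fin (le_trans (f_le x)).
by apply: ereal_sup_ubound; exists e; rewrite /= ?fe1 ?e1.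
Qed.

Lemma dim_lker_surj (K : fieldType) (V W : vectType K) (f : {linear V -> W}) :
  (forall w, exists v, f v = w) ->
  (\dim (lker (linfun f)) + \dim {:W} = \dim {:V})%N.
Proof.
move=> f_surj; rewrite -(limg_ker_dim (linfun f) fullv) capfv.
congr (_ + \dim _)%N; apply/vspaceP => w; rewrite memvf; apply/esym/memv_imgP.
by have [v <-] := f_surj w; exists v; rewrite ?memvf// lfunE.
Qed.

Lemma daddv_piD (K : fieldType) (V : vectType K) (U W : {vspace V}) u w :
  (U :&: W = 0)%VS -> u \in U -> w \in W -> daddv_pi U W (u + w) = u.
Proof.
move=> UW0 Uu Ww; rewrite linearD /= daddv_pi_id//.
have := daddv_pi_add UW0 (subvP (addvSr U W) w Ww).
rewrite [X in _ + X]daddv_pi_id 1?capvC// => /(canRL (addrK _)).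
by rewrite subrr => ->; rewrite addr0.
Qed.

Lemma exists_unit_ker (R : realType) (X : finBanachType R)
    (f : {linear X -> R^o}) :
  (1 < \dim {:X})%N -> exists2 x, `|x| = 1 & f x = 0.
Proof.
move=> dimX; set v := vpick (lker (linfun f)).
have v0 : v != 0.
  rewrite vpick0 -dimv_eq0; apply: contraTneq dimX => ker0.
  rewrite -(limg_ker_dim (linfun f) fullv) capfv ker0 add0n -leqNgt.
  by apply: leq_trans (dimvS (subvf _)) _; rewrite dimvf.
have fv : f v = 0.
  by have := memv_pick (lker (linfun f)); rewrite memv_ker lfunE => /eqP.
exists (`|v|^-1 *: v); last by rewrite linearZ/= fv scaler0.
by rewrite normrZ normfV normr_id mulVf ?normr_eq0.
Qed.

Section restrict_dot.
Variables (R : realType) (X : vectType R).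
Variables (B : {dot X for (idfun : R -> R)}) (V : {vspace X}).

Definition restrict_dot (u v : subvs_of V) : R := B (vsval u) (vsval v).

Fact restrict_dot_bilinear : bilinear_for *%R (idfun \; *%R) restrict_dot.
Proof. by split=> u k x y; [exact: linearPl|exact: linearPr]. Qed.
HB.instance Definition _ := @bilinear_isBilinear.Build R (subvs_of V)
  (subvs_of V) R *%R (idfun \; *%R) restrict_dot restrict_dot_bilinear.

Fact restrict_dot_sym u v :
  restrict_dot u v = (-1) ^+ false * idfun (restrict_dot v u).
Proof. exact: hermC. Qed.
HB.instance Definition _ := @isHermitianSesquilinear.Build R (subvs_of V)
  false idfun restrict_dot restrict_dot_sym.

Fact restrict_dot_gt0 u : u != 0 -> 0 < restrict_dot u u.
Proof.
move=> u_neq0; apply: neq0_dnorm_gt0; apply: contra_neq u_neq0 => u0.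
exact/val_inj.
Qed.
HB.instance Definition _ :=
  @isDotProduct.Build R (subvs_of V) restrict_dot restrict_dot_gt0.

End restrict_dot.

Lemma euclidean_subspace_dot (R : realType) (X : finBanachType R)
    (B : {dot X for (idfun : R -> R)}) (V : {vspace X}) :
  {in V, forall x, `|x| ^+ 2 = B x x} -> euclidean_subspace V.
Proof.
move=> normE.
exists (restrict_dot B (V := V) : {dot (subvs_of V) for idfun}) => u /=.
by rewrite normE ?subvsP.
Qed.

(** * Bilipschitz maps into strongly convex spaces *)

Section strongly_convex_spaces.
Variables (R : realType) (Y X : normedModType R).
Implicit Types (T : Y -> X) (K eta c l : R).

Definition strongly_convex_norm c := forall l (x y : X), 0 <= l <= 1 ->
  `|(1 - l) *: x + l *: y| ^+ 2 + c * (l * (1 - l)) * `|x - y| ^+ 2 <=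
  (1 - l) * `|x| ^+ 2 + l * `|y| ^+ 2.

Definition bilipschitz K T := forall x y,
  K^-1 * `|x - y| <= `|T x - T y| <= K * `|x - y|.

Definition approx_affine eta T := forall x y l, 0 <= l <= 1 ->
  `|T ((1 - l) *: x + l *: y) - ((1 - l) *: T x + l *: T y)| <=
  eta * `|x - y|.

Lemma strongly_convex_normD c l (x y : X) :
  strongly_convex_norm c -> 0 <= l <= 1 ->
  l * (1 - l) * `|x + y| ^+ 2 + c * `|(1 - l) *: x - l *: y| ^+ 2 <=
  (1 - l) * `|x| ^+ 2 + l * `|y| ^+ 2.
Proof.
move=> convX /andP[l0 l1].
have c_le1 (z : X) : c * `|z| ^+ 2 <= `|z| ^+ 2.
  have half : 0 <= (2^-1 : R) <= 1 by lra.
  have := convX _ z (- z) half; have -> : 1 - 2^-1 = 2^-1 :> R by lra.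
  rewrite (_ : z - - z = 2 *: z); last by rewrite opprK scaler_nat mulr2n.
  by rewrite scalerN subrr normr0 normrN normrZ gtr0_norm// exprMn; lra.
have [->|ln0] := eqVneq l 0.
  by rewrite !mul0r subr0 !mul1r !scale0r subr0 scale1r add0r addr0.
have [->|ln1] := eqVneq l 1.
  by rewrite subrr mulr0 !mul0r !scale0r sub0r !add0r scale1r normrN mul1r.
have {}l0 : 0 < l by rewrite lt_def ln0.
have k0 : 0 < 1 - l by rewrite subr_gt0 lt_def eq_sym ln1.
have k01 : 0 <= 1 - l <= 1 by rewrite (ltW k0) gerBl ltW.
have := convX _ (l^-1 *: x) ((1 - l)^-1 *: y) k01.
rewrite (subKr 1 l) !scalerA !divff ?gt_eqF// !scale1r.
have -> : l^-1 *: x - (1 - l)^-1 *: y =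
    (l * (1 - l))^-1 *: ((1 - l) *: x - l *: y).
  by rewrite scalerBr !scalerA; congr (_ *: _ - _ *: _); field; rewrite !gt_eqF.
rewrite !normrZ !exprMn !gtr0_norm ?invr_gt0 ?mulr_gt0//.
move=> /(ler_wpM2l (ltW (mulr_gt0 l0 k0))).
by congr (_ <= _); field; rewrite !gt_eqF.
Qed.

(* The images of the two parts of a segment are as long as their distances
   allow, up to the factor K^2, and add up to a vector that is almost as long:
   strong convexity then forces them to be almost parallel. *)
Lemma bilipschitz_approx_affine c K eta T :
  0 < c -> strongly_convex_norm c -> 0 < K -> 0 <= eta ->
  K ^+ 2 - K ^- 2 <= 4 * c * eta ^+ 2 -> bilipschitz K T -> approx_affine eta T.
Proof.
move=> c0 convX K0 eta0 K_eta TK x y l /andP[l0 l1].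
have k0 : 0 <= 1 - l by rewrite subr_ge0.
set m := (1 - l) *: x + l *: y; set d := `|x - y|; set D := T m - _.
have d0 : 0 <= d by exact: normr_ge0.
have dist_mx : `|m - x| = l * d.
  rewrite distrC (_ : x - m = l *: (x - y)) ?normrZ ?ger0_norm//.
  by rewrite /m (scalerBl 1 l x) scale1r scalerBr opprD addrA subKr.
have dist_ym : `|y - m| = (1 - l) * d.
  rewrite distrC (_ : m - y = (1 - l) *: (x - y)) ?normrZ ?ger0_norm//.
  by rewrite /m scalerBr (scalerBl 1 l y) scale1r opprB addrA.
have T_le u v : `|T u - T v| ^+ 2 <= K ^+ 2 * `|u - v| ^+ 2.
  rewrite -exprMn ler_pXn2r ?nnegrE ?mulr_ge0 ?(ltW K0)//.
  by case/andP: (TK u v).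
have T_ge : K ^- 2 * d ^+ 2 <= `|T y - T x| ^+ 2.
  rewrite -exprVn -exprMn ler_pXn2r ?nnegrE ?mulr_ge0 ?invr_ge0 ?(ltW K0)//.
  by rewrite /d distrC; case/andP: (TK y x).
have D_le : c * `|D| ^+ 2 <= l * (1 - l) * ((K ^+ 2 - K ^- 2) * d ^+ 2).
  have lk0 := mulr_ge0 l0 k0.
  have := strongly_convex_normD (T m - T x) (T y - T m) convX (l := l).
  rewrite (addrC (T m - T x)) subrKA l0 l1 => /(_ isT).
  have -> : (1 - l) *: (T m - T x) - l *: (T y - T m) = D.
    by rewrite /D !scalerBr opprB addrACA -scalerDl subrK scale1r opprD.
  have := ler_wpM2l k0 (T_le m x); have := ler_wpM2l l0 (T_le y m).
  by have := ler_wpM2l lk0 T_ge; rewrite dist_mx dist_ym !exprMn; lra.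
have quarter : l * (1 - l) <= 1 / 4 by have := sqr_ge0 (l - 1 / 2); nra.
rewrite -(@ler_pXn2r _ 2) ?nnegrE ?mulr_ge0// exprMn -(ler_pM2l c0).
apply: (le_trans D_le); apply: le_trans (ler_wpM2l (mulr_ge0 l0 k0)
  (ler_wpM2r (sqr_ge0 d) K_eta)) _.
have := ler_wpM2r (_ : 0 <= 4 * c * eta ^+ 2 * d ^+ 2) quarter.
by rewrite !mulr_ge0 ?sqr_ge0 ?(ltW c0)// => /(_ isT); lra.
Qed.

End strongly_convex_spaces.

Section approx_affine_maps.
Variables (R : realType) (Y X : normedModType R) (eta : R) (T : Y -> X).
Hypotheses (eta_ge0 : 0 <= eta) (T0 : T 0 = 0) (T_affine : approx_affine eta T).
Implicit Types (v w : Y) (k : R).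

Lemma approx_affineZ01 k v :
  0 <= k <= 1 -> `|T (k *: v) - k *: T v| <= eta * `|v|.
Proof. by move=> /(T_affine 0 v); rewrite T0 !scaler0 !add0r normrN. Qed.

Lemma approx_affineD v w :
  `|T (v + w) - (T v + T w)| <= 4 * eta * (`|v| + `|w|).
Proof.
have half : 0 <= (2^-1 : R) <= 1 by lra.
have T_half u : `|2^-1 *: T (2 *: u) - T u| <= 2 * eta * `|u|.
  have := approx_affineZ01 (2 *: u) half.
  by rewrite scalerK// distrC normrZ gtr0_norm// mulrCA mulrA.
have T_mid : `|T (v + w) - (2^-1 *: T (2 *: v) + 2^-1 *: T (2 *: w))| <=
    2 * eta * `|v - w|.
  have := T_affine (2 *: v) (2 *: w) half.
  have -> : 1 - 2^-1 = 2^-1 :> R by lra.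
  by rewrite !scalerK// -scalerBr normrZ gtr0_norm// mulrCA mulrA.
have -> : T (v + w) - (T v + T w) =
    T (v + w) - (2^-1 *: T (2 *: v) + 2^-1 *: T (2 *: w))
    + ((2^-1 *: T (2 *: v) - T v) + (2^-1 *: T (2 *: w) - T w)).
  by rewrite [X in _ = _ + X]addrACA -opprD addrA subrK.
apply: le_trans (ler_normD _ _) _.
have := le_trans (ler_normD _ _) (lerD (T_half v) (T_half w)).
have := ler_wpM2l eta_ge0 (ler_normB v w); lra.
Qed.

Lemma approx_affineZ k v :
  `|k| <= 1 -> `|T (k *: v) - k *: T v| <= 9 * eta * `|v|.
Proof.
move=> k1; have v0 := mulr_ge0 eta_ge0 (normr_ge0 v).
have [k0|k0] := leP 0 k.
  have := approx_affineZ01 v (k := k).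
  by rewrite k0 -(ger0_norm k0) k1 => /(_ isT); rewrite (ger0_norm k0); lra.
have Nk : 0 <= - k <= 1 by rewrite oppr_ge0 (ltW k0) -(ltr0_norm k0).
have T_neg : `|T (k *: v) + k *: T (- v)| <= eta * `|v|.
  have := approx_affineZ01 (- v) Nk.
  by rewrite scaleNr scalerN !scaleNr !opprK normrN.
have T_odd : `|T (- v) + T v| <= 8 * eta * `|v|.
  have := approx_affineD v (- v).
  by rewrite subrr T0 sub0r normrN normrN addrC; lra.
have -> : T (k *: v) - k *: T v =
    T (k *: v) + k *: T (- v) - k *: (T (- v) + T v).
  by rewrite scalerDr opprD addrA addrK.
apply: le_trans (ler_normB _ _) _; rewrite normrZ.
have := ler_piMl (normr_ge0 (T (- v) + T v)) k1; lra.
Qed.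

Lemma approx_affine_sum m (v : 'I_m -> Y) :
  `|T (\sum_i v i) - \sum_i T (v i)| <= 4 * m%:R * eta * \sum_i `|v i|.
Proof.
elim: m v => [|m IHm] v.
  by rewrite !big_ord0 T0 subrr normr0 mulr0.
rewrite !big_ord_recl; set s := \sum_i v _; set Ts := \sum_i T _.
set S := \sum_i `|_|; have S0 : 0 <= S by rewrite sumr_ge0.
have sS : `|s| <= S by exact: ler_norm_sum.
have -> : T (v ord0 + s) - (T (v ord0) + Ts) =
    T (v ord0 + s) - (T (v ord0) + T s) + (T s - Ts).
  by rewrite opprD addrA [in RHS]opprD !addrA subrK.
apply: le_trans (ler_normD _ _) _.
apply: le_trans (lerD (approx_affineD _ _) (IHm _)) _.
rewrite -/S -natr1.
have := ler_wpM2l eta_ge0 sS.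
have := mulr_ge0 (mulr_ge0 (ler0n R m) eta_ge0) (normr_ge0 (v ord0)).
lra.
Qed.

End approx_affine_maps.

Section bilipschitz_maps.
Variable R : realType.

Lemma Lip_fin_klipschitz (Y X : normedModType R) (A : set Y) (f : Y -> X) :
  (Lip A f < +oo)%E ->
  exists k : R, [/\ Lip A f = k%:E, 0 <= k & k.-lipschitz_A f].
Proof.
move=> Lip_lty.
have Lip_ge0 : (0 <= Lip A f)%E by apply: le_ereal_inf_tmp => _ [k [? _] <-].
have LipE : Lip A f = (fine (Lip A f))%:E by rewrite fineK// ge0_fin_numE.
exists (fine (Lip A f)); split=> //; first exact: fine_ge0.
move=> [x y] Axy /=; have [->|xy] := eqVneq x y.
  by rewrite !subrr !normr0 mulr0.
have xy0 : 0 < `|x - y| by rewrite normr_gt0 subr_eq0.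
rewrite -ler_pdivrMr// -lee_fin -LipE.
apply: le_ereal_inf_tmp => _ [k [_ fk] <-].
by rewrite lee_fin ler_pdivrMr//; exact: (fk (x, y)).
Qed.

(* An isometric pair bounds both Lipschitz constants below by 1, so that each of
   them is at most their product. *)
Lemma distortion_le_bilipschitz (Y X : normedModType R) (C : R) (T : Y -> X)
    (x0 y0 : Y) :
  x0 != y0 -> `|T x0 - T y0| = `|x0 - y0| -> 0 < C ->
  bilipschitz_distortion_le T C -> bilipschitz C T.
Proof.
move=> xy0 iso0 C0 [S [TK /Lip_fin_klipschitz[k [-> k0 Tk]]]].
move=> /Lip_fin_klipschitz[k' [-> k'0 Sk']]; rewrite -EFinM lee_fin => kk'.
have d0 : 0 < `|x0 - y0| by rewrite normr_gt0 subr_eq0.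
have T_le x y : `|T x - T y| <= k * `|x - y| by exact: (Tk (x, y) (conj I I)).
have T_ge x y : `|x - y| <= k' * `|T x - T y|.
  rewrite -{1}(TK x) -{1}(TK y); apply: (Sk' (T x, T y)).
  by split; [exists x|exists y].
have k1 : 1 <= k by have := T_le x0 y0; rewrite iso0 ler_pMl.
have k'1 : 1 <= k' by have := T_ge x0 y0; rewrite iso0 ler_pMl.
have kC : k <= C by apply: le_trans kk'; rewrite ler_peMr.
have k'C : k' <= C by apply: le_trans kk'; rewrite ler_peMl.
move=> x y; rewrite mulrC ler_pdivrMr// [_ * C]mulrC.
by rewrite (le_trans (T_ge x y)) ?ler_wpM2r// (le_trans (T_le x y)) ?ler_wpM2r.
Qed.

Lemma bilipschitz_rescale (Y X : normedModType R) (K s : R) (T : Y -> X) :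
  0 < s -> bilipschitz K T -> bilipschitz K (fun v => s^-1 *: T (s *: v)).
Proof.
move=> s0 TK x y; rewrite -scalerBr normrZ gtr0_norm ?invr_gt0//.
rewrite ler_pdivlMl// ler_pdivrMl// !(mulrCA s).
rewrite -(gtr0_norm s0) -normrZ gtr0_norm// scalerBr; exact: TK.
Qed.

End bilipschitz_maps.

Section near_isometries.
Variable R : realType.

Definition near_isometry (Y X : normedModType R) (d : R) (L : Y -> X) :=
  forall v, `| `|L v| ^+ 2 - `|v| ^+ 2 | <= d * `|v| ^+ 2.

Lemma near_isometry_approx (Y X : normedModType R) (K eta : R) (T : Y -> X)
    (L : {linear Y -> X}) :
  0 < K -> K - 1 + eta <= 1 -> T 0 = 0 -> bilipschitz K T ->
  (forall v, `|v| <= 1 -> `|T v - L v| <= eta) ->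
  near_isometry (3 * (K - 1 + eta)) L.
Proof.
move=> K0 K_eta T0 TK TL v; set d := K - 1 + eta.
have [->|v0] := eqVneq v 0.
  by rewrite linear0 !normr0 expr0n subr0 normr0 mulr0.
have nv0 : `|v| != 0 by rewrite normr_eq0.
pose w := `|v|^-1 *: v.
have w1 : `|w| = 1 by rewrite normrZ normfV normr_id mulVf.
have unit : `| `|L w| ^+ 2 - 1| <= 3 * d.
  have TLw : `|T w - L w| <= eta by rewrite TL ?w1.
  have := TK w 0; rewrite T0 !subr0 w1 !mulr1 => /andP[Tw_ge Tw_le].
  have KV : 2 - K <= K^-1.
    rewrite -[leRHS]mul1r ler_pdivlMr//; have := sqr_ge0 (K - 1); lra.
  have := lerB_dist (L w) (T w); rewrite distrC.
  have := lerB_dist (T w) (L w); have := normr_ge0 (L w).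
  rewrite /d ler_norml => Lw0 Lw_ge Lw_le; apply/andP; split; nra.
have -> : L v = `|v| *: L w by rewrite linearZ/= scalerA divff// scale1r.
rewrite normrZ normr_id exprMn -[X in `|_ - X|]mulr1 -mulrBr normrM.
by rewrite ger0_norm ?sqr_ge0// mulrC ler_wpM2r ?sqr_ge0.
Qed.

Definition sqnorm_second_difference (X : normedModType R) (x y : X) : R :=
  `|x + y| ^+ 2 + `|x - y| ^+ 2 - 2 * `|x| ^+ 2.

End near_isometries.

(** * The spaces l2 R n *)

Section l2_coordinates.
Variables (R : realType) (n : nat).
Implicit Types a b : l2 R n.

Definition l2coord (i : 'I_n) a : R := (a : 'rV[R]_n) ord0 i.

Fact l2coord_scalar i : scalar (l2coord i).
Proof. by move=> k a b; rewrite /l2coord mxE; congr (_ + _); rewrite mxE. Qed.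
HB.instance Definition _ i :=
  GRing.isLinear.Build R (l2 R n) R *%R (l2coord i) (l2coord_scalar i).

Definition l2basis (i : 'I_n) : l2 R n := delta_mx ord0 i.

Lemma l2coord_basis i j : l2coord i (l2basis j) = (i == j)%:R.
Proof. by rewrite /l2coord mxE eqxx. Qed.

Lemma l2_sum_basis a : a = \sum_i l2coord i a *: l2basis i.
Proof. exact: row_sum_delta. Qed.

Lemma dim_l2 : \dim {: l2 R n} = n.
Proof. by rewrite dimvf; exact: mul1n. Qed.

Lemma l2_sqrnormE a : `|a| ^+ 2 = \sum_i l2coord i a ^+ 2.
Proof. by rewrite l2_normE sqr_sqrtr// sumr_ge0// => i _; exact: sqr_ge0. Qed.

Lemma l2coord_le a i : `|l2coord i a| <= `|a|.
Proof.
rewrite -(@ler_pXn2r _ 2) ?nnegrE// real_normK ?num_real// l2_sqrnormE.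
by rewrite (bigD1 i)//= lerDl sumr_ge0// => j _; exact: sqr_ge0.
Qed.

Lemma l2basis_norm i : `|l2basis i| = 1.
Proof.
apply/eqP; rewrite -(@eqrXn2 _ 2)// expr1n l2_sqrnormE (bigD1 i)//= big1.
  by rewrite l2coord_basis eqxx expr1n addr0.
by move=> j ji; rewrite l2coord_basis (negbTE ji) expr0n.
Qed.

Lemma l2_sqrnorm_conv l a b :
  `|(1 - l) *: a + l *: b| ^+ 2 + l * (1 - l) * `|a - b| ^+ 2 =
  (1 - l) * `|a| ^+ 2 + l * `|b| ^+ 2.
Proof.
rewrite !l2_sqrnormE !mulr_sumr -!big_split; apply: eq_bigr => i _ /=.
by rewrite linearB linearD !linearZ/=; ring.
Qed.

Lemma l2_parallelogram a b :
  `|a + b| ^+ 2 + `|a - b| ^+ 2 = 2 * `|a| ^+ 2 + 2 * `|b| ^+ 2.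
Proof.
rewrite !l2_sqrnormE !mulr_sumr -!big_split; apply: eq_bigr => i _ /=.
by rewrite linearB linearD/=; ring.
Qed.

Lemma l2coord_max a :
  (0 < n)%N -> exists i, `|a| ^+ 2 <= n%:R * l2coord i a ^+ 2.
Proof.
move=> n0; have i0 := Ordinal n0.
have [i _ i_max] := arg_maxP (fun i => l2coord i a ^+ 2) (erefl (xpredT i0)).
exists i; rewrite l2_sqrnormE mulr_natl -[n in _ *+ n]card_ord -sumr_const.
by apply: ler_sum => j _; exact: i_max.
Qed.

End l2_coordinates.

Section l2_linear_maps.
Variables (R : realType) (m : nat) (X : normedModType R).

Definition l2_lincomb (u : 'I_m -> X) (v : l2 R m) : X :=
  \sum_i l2coord i v *: u i.

Fact l2_lincomb_linear u : linear (l2_lincomb u).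
Proof.
move=> k v w; rewrite /l2_lincomb scaler_sumr -big_split.
by apply: eq_bigr => i _ /=; rewrite linearP scalerDl scalerA.
Qed.
HB.instance Definition _ u :=
  GRing.isLinear.Build R (l2 R m) X *:%R (l2_lincomb u) (l2_lincomb_linear u).

Lemma l2_lincomb_basis u i : l2_lincomb u (l2basis R i) = u i.
Proof.
rewrite /l2_lincomb (bigD1 i)//= big1 => [|j ji].
  by rewrite l2coord_basis eqxx scale1r addr0.
by rewrite l2coord_basis (negbTE ji) scale0r.
Qed.

Lemma approx_affine_lincomb (eta : R) (T : l2 R m -> X) (v : l2 R m) :
  0 <= eta -> T 0 = 0 -> approx_affine eta T -> `|v| <= 1 ->
  `|T v - l2_lincomb (T \o @l2basis R m) v| <= (4 * m%:R + 9) * m%:R * eta.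
Proof.
move=> eta0 T0 T_affine v1.
have coord1 i : `|l2coord i v| <= 1 := le_trans (l2coord_le v i) v1.
have sum_const k : \sum_(i < m) k = m%:R * k :> R.
  by rewrite sumr_const card_ord mulr_natl.
pose s := \sum_i T (l2coord i v *: l2basis R i).
have sum_err : `|T v - s| <= 4 * m%:R * eta * m%:R.
  rewrite {1}[v]l2_sum_basis.
  apply: le_trans (approx_affine_sum eta0 T0 T_affine _) _.
  rewrite ler_wpM2l ?mulr_ge0// -[leRHS]mulr1 -sum_const ler_sum// => i _.
  by rewrite normrZ l2basis_norm mulr1.
have scale_err : `|s - l2_lincomb (T \o @l2basis R m) v| <= m%:R * (9 * eta).
  rewrite /s /l2_lincomb -sumrB; apply: le_trans (ler_norm_sum _ _ _) _.
  rewrite -sum_const ler_sum// => i _.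
  apply: le_trans (approx_affineZ eta0 T0 T_affine _ (coord1 i)) _.
  by rewrite l2basis_norm mulr1.
rewrite -(subrKA s); apply: le_trans (ler_normD _ _) _; lra.
Qed.

Lemma near_isometry_second_difference (d : R) (L : {linear l2 R m -> X}) v w :
  near_isometry d L ->
  sqnorm_second_difference (L v) (L w) <=
  2 * (1 + d) * `|w| ^+ 2 + 4 * d * `|v| ^+ 2.
Proof.
move=> Ld; have := congr1 ( *%R d) (l2_parallelogram v w).
have := l2_parallelogram v w.
have := Ld (v + w); have := Ld (v - w); have := Ld v.
rewrite linearB linearD /sqnorm_second_difference !ler_norml.
by move=> /andP[? _] /andP[_ ?] /andP[_ ?]; lra.
Qed.

End l2_linear_maps.

(** * The kinked norm *)

(* An alias of the product, whose canonical norm is the maximum of the norms of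
   the two components. *)
Definition kinked_sum (R : realType) (n : nat) : Type := (l2 R n * l2 R n)%type.

Section kinked_sum_norm.
Variables (R : realType) (n : nat).

HB.instance Definition _ := Vector.copy (kinked_sum R n) (l2 R n * l2 R n)%type.

Implicit Types x y : kinked_sum R n.

Definition kfst x : l2 R n := x.1.
Definition ksnd x : l2 R n := x.2.

Fact kfst_linear : linear kfst. Proof. by []. Qed.
Fact ksnd_linear : linear ksnd. Proof. by []. Qed.
HB.instance Definition _ :=
  GRing.isLinear.Build R (kinked_sum R n) (l2 R n) *:%R kfst kfst_linear.
HB.instance Definition _ :=
  GRing.isLinear.Build R (kinked_sum R n) (l2 R n) *:%R ksnd ksnd_linear.

Definition kswap x : kinked_sum R n := (ksnd x, kfst x).

Fact kswap_linear : linear kswap. Proof. by []. Qed.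
HB.instance Definition _ :=
  GRing.isLinear.Build R (kinked_sum R n) (kinked_sum R n) *:%R kswap
    kswap_linear.

Definition kinked_cross x : R :=
  n%:R^-1 * \sum_i \sum_j `|l2coord i (kfst x)| * `|l2coord j (ksnd x)|.

Definition eucl_sqnorm x : R := `|kfst x| ^+ 2 + `|ksnd x| ^+ 2.

Definition kinked_sqnorm x : R := eucl_sqnorm x + kinked_cross x.

Definition kinked_norm x : R := Num.sqrt (kinked_sqnorm x).

Lemma eucl_sqnorm_ge0 x : 0 <= eucl_sqnorm x.
Proof. by rewrite addr_ge0 ?sqr_ge0. Qed.

Lemma eucl_sqnormZ k x : eucl_sqnorm (k *: x) = k ^+ 2 * eucl_sqnorm x.
Proof.
by rewrite /eucl_sqnorm !linearZ !normrZ !exprMn real_normK ?num_real// mulrDr.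
Qed.

Lemma eucl_sqnorm_eq0 x : eucl_sqnorm x = 0 -> x = 0.
Proof.
move=> /eqP; rewrite paddr_eq0 ?sqr_ge0// !sqrf_eq0 !normr_eq0 /kfst /ksnd.
by case: x => a b /andP[/= /eqP -> /eqP ->].
Qed.

Lemma eucl_sqnorm_conv l x y :
  eucl_sqnorm ((1 - l) *: x + l *: y) + l * (1 - l) * eucl_sqnorm (x - y) =
  (1 - l) * eucl_sqnorm x + l * eucl_sqnorm y.
Proof.
have := l2_sqrnorm_conv l (kfst x) (kfst y).
have := l2_sqrnorm_conv l (ksnd x) (ksnd y).
rewrite /eucl_sqnorm !linearB !linearD !linearZ /=; lra.
Qed.

Lemma eucl_sqnorm_parallelogram x y :
  eucl_sqnorm (x + y) + eucl_sqnorm (x - y) =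
  2 * eucl_sqnorm x + 2 * eucl_sqnorm y.
Proof.
have := l2_parallelogram (kfst x) (kfst y).
have := l2_parallelogram (ksnd x) (ksnd y).
rewrite /eucl_sqnorm !linearB !linearD /=; lra.
Qed.

Lemma kinked_cross_ge0 x : 0 <= kinked_cross x.
Proof.
rewrite mulr_ge0 ?invr_ge0//; apply: sumr_ge0 => i _; apply: sumr_ge0 => j _.
exact: mulr_ge0.
Qed.

Lemma kinked_cross_swap x : kinked_cross (kswap x) = kinked_cross x.
Proof.
rewrite /kinked_cross exchange_big; congr (_ * _); apply: eq_bigr => i _.
by apply: eq_bigr => j _; rewrite mulrC.
Qed.

Lemma kinked_cross0l x : kfst x = 0 -> kinked_cross x = 0.
Proof.
move=> x0; rewrite /kinked_cross big1 ?mulr0// => i _.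
by rewrite big1// => j _; rewrite x0 linear0 normr0 mul0r.
Qed.

Lemma kinked_cross0r x : ksnd x = 0 -> kinked_cross x = 0.
Proof. by move=> x2; rewrite -kinked_cross_swap; exact: kinked_cross0l. Qed.

Lemma sum_sqr_normrD x :
  \sum_i \sum_j (`|l2coord i (kfst x)| + `|l2coord j (ksnd x)|) ^+ 2 =
  n%:R * eucl_sqnorm x +
  2 * \sum_i \sum_j `|l2coord i (kfst x)| * `|l2coord j (ksnd x)|.
Proof.
have -> : n%:R * eucl_sqnorm x =
    \sum_i \sum_j (l2coord i (kfst x) ^+ 2 + l2coord j (ksnd x) ^+ 2).
  under [RHS]eq_bigr do rewrite big_split sumr_const card_ord /=.
  rewrite big_split sumrMnl sumr_const card_ord -!l2_sqrnormE.
  by rewrite mulrDr !mulr_natl.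
rewrite mulr_sumr -big_split; apply: eq_bigr => i _ /=.
rewrite mulr_sumr -big_split; apply: eq_bigr => j _ /=.
by rewrite sqrrD !real_normK ?num_real//; ring.
Qed.

Lemma kinked_cross_le x : kinked_cross x <= eucl_sqnorm x / 2.
Proof.
set E := eucl_sqnorm x.
set S := \sum_i \sum_j `|l2coord i (kfst x)| * `|l2coord j (ksnd x)|.
have S_le : 2 * S <= n%:R * E.
  suff : 4 * S <= n%:R * E + 2 * S by lra.
  rewrite -sum_sqr_normrD mulr_sumr; apply: ler_sum => i _.
  rewrite mulr_sumr; apply: ler_sum => j _.
  by have := sqr_ge0 (`|l2coord i (kfst x)| - `|l2coord j (ksnd x)|); lra.
have nV0 : 0 <= n%:R^-1 :> R by rewrite invr_ge0.
have E0 : 0 <= E by exact: eucl_sqnorm_ge0.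
rewrite /kinked_cross -/S; have := ler_wpM2l nV0 S_le.
have := ler_wpM2r E0 (natVM_le1 R n); lra.
Qed.

Lemma kinked_sqnorm_ge x : eucl_sqnorm x <= kinked_sqnorm x.
Proof. by rewrite lerDl kinked_cross_ge0. Qed.

Lemma kinked_sqnorm_le x : kinked_sqnorm x <= 3 / 2 * eucl_sqnorm x.
Proof. by have := kinked_cross_le x; rewrite /kinked_sqnorm; lra. Qed.

Lemma kinked_sqnorm_ge0 x : 0 <= kinked_sqnorm x.
Proof. exact: le_trans (eucl_sqnorm_ge0 x) (kinked_sqnorm_ge x). Qed.

Lemma kinked_sqnorm_eq0 x : kinked_sqnorm x = 0 -> x = 0.
Proof.
move=> x0; apply/eucl_sqnorm_eq0/eqP.
by rewrite eq_le eucl_sqnorm_ge0 andbT -x0 kinked_sqnorm_ge.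
Qed.

Lemma kinked_sqnormZ k x : kinked_sqnorm (k *: x) = k ^+ 2 * kinked_sqnorm x.
Proof.
rewrite /kinked_sqnorm eucl_sqnormZ [RHS]mulrDr; congr (_ + _).
rewrite /kinked_cross mulrCA; congr (_ * _).
rewrite mulr_sumr; apply: eq_bigr => i _.
rewrite mulr_sumr; apply: eq_bigr => j _.
by rewrite !linearZ/= !normrM -(real_normK (num_real k)); ring.
Qed.

(* The squared norm is the sum of at least half of the Euclidean one and of a
   multiple of the squares of the seminorms |a_i| + |b_j|. *)
Lemma kinked_sqnorm_strongly_convex l x y : 0 <= l <= 1 ->
  kinked_sqnorm ((1 - l) *: x + l *: y)
    + 3^-1 * (l * (1 - l)) * kinked_sqnorm (x - y) <=
  (1 - l) * kinked_sqnorm x + l * kinked_sqnorm y.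
Proof.
move=> l01.
pose F z := \sum_i \sum_j (`|l2coord i (kfst z)| + `|l2coord j (ksnd z)|) ^+ 2.
have sqnormE z : kinked_sqnorm z =
    (1 - n%:R^-1 * n%:R / 2) * eucl_sqnorm z + n%:R^-1 / 2 * F z.
  rewrite /F sum_sqr_normrD /kinked_sqnorm /kinked_cross.
  by move: n%:R^-1 => t; field.
have F_convex : F ((1 - l) *: x + l *: y) <= (1 - l) * F x + l * F y.
  rewrite /F !mulr_sumr -big_split; apply: ler_sum => i _ /=.
  rewrite !mulr_sumr -big_split; apply: ler_sum => j _ /=.
  apply: sqr_le_conv => //; rewrite !linearD !linearZ/=.
  have := normr_conv_le (l2coord i (kfst x)) (l2coord i (kfst y)) l01.
  have := normr_conv_le (l2coord j (ksnd x)) (l2coord j (ksnd y)) l01.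
  lra.
have l0 : 0 <= l * (1 - l) by case/andP: l01 => *; rewrite mulr_ge0 ?subr_ge0.
have nV0 : 0 <= n%:R^-1 / 2 :> R by rewrite divr_ge0 ?invr_ge0.
have := ler_wpM2l l0 (kinked_sqnorm_le (x - y)); have := ler_wpM2l nV0 F_convex.
have := ler_wpM2r (mulr_ge0 l0 (eucl_sqnorm_ge0 (x - y))) (natVM_le1 R n).
have := congr1 ( *%R (1 - n%:R^-1 * n%:R / 2)) (eucl_sqnorm_conv l x y).
move: (kinked_sqnorm (x - y)) => q; rewrite !sqnormE; lra.
Qed.

End kinked_sum_norm.

Section kinked_sum_space.
Variables (R : realType) (n : nat).
Local Notation X := (kinked_sum R n).
Implicit Types x y : X.

Fact kinked_normD x y : kinked_norm (x + y) <= kinked_norm x + kinked_norm y.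
Proof.
apply: (sqrt_subadditive (@kinked_sqnorm_ge0 R n) (@kinked_sqnorm_eq0 R n)
  (@kinked_sqnormZ R n)) => l {}x {}y l01.
apply: le_trans (kinked_sqnorm_strongly_convex x y l01).
have [l0 l1] := andP l01.
by rewrite lerDl !mulr_ge0 ?invr_ge0 ?subr_ge0 ?kinked_sqnorm_ge0.
Qed.

Fact kinked_normZ k x : kinked_norm (k *: x) = `|k| * kinked_norm x.
Proof. by rewrite /kinked_norm kinked_sqnormZ sqrtrM ?sqr_ge0// sqrtr_sqr. Qed.

Fact kinked_norm_eq0 x : kinked_norm x = 0 -> x = 0.
Proof.
move/eqP; rewrite sqrtr_eq0 => x_le0; apply: kinked_sqnorm_eq0.
by apply/eqP; rewrite eq_le x_le0 kinked_sqnorm_ge0.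
Qed.

HB.instance Definition _ :=
  Lmodule_isNormed.Build R X kinked_normD kinked_normZ kinked_norm_eq0.

Lemma kinked_sqrnormE x : `|x| ^+ 2 = kinked_sqnorm x.
Proof. exact/sqr_sqrtr/kinked_sqnorm_ge0. Qed.

Lemma eucl_sqnorm_le x : eucl_sqnorm x <= `|x| ^+ 2.
Proof. by rewrite kinked_sqrnormE kinked_sqnorm_ge. Qed.

Lemma eucl_sqnorm_ge x : `|x| ^+ 2 <= 3 / 2 * eucl_sqnorm x.
Proof. by rewrite kinked_sqrnormE kinked_sqnorm_le. Qed.

Lemma kswap_norm x : `|kswap x| = `|x|.
Proof.
apply/eqP; rewrite -(@eqrXn2 _ 2)// !kinked_sqrnormE /kinked_sqnorm.
by rewrite kinked_cross_swap /eucl_sqnorm [X in X + _ == _]addrC.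
Qed.

Lemma kfst_le x : `|kfst x| <= `|x|.
Proof.
rewrite -(@ler_pXn2r _ 2) ?nnegrE//; apply: le_trans (eucl_sqnorm_le x).
by rewrite lerDl sqr_ge0.
Qed.

Lemma ksnd_le x : `|ksnd x| <= `|x|.
Proof. by rewrite -kswap_norm; exact: kfst_le (kswap x). Qed.

Lemma kinked_norm_le x : `|x| <= 2 * (`|kfst x| + `|ksnd x|).
Proof.
rewrite -(@ler_pXn2r _ 2) ?nnegrE ?mulr_ge0 ?addr_ge0//.
apply: le_trans (eucl_sqnorm_ge x) _; rewrite /eucl_sqnorm.
have := mulr_ge0 (normr_ge0 (kfst x)) (normr_ge0 (ksnd x)).
have := (sqr_ge0 `|kfst x|, sqr_ge0 `|ksnd x|) => -[]; lra.
Qed.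

Lemma kinked_strongly_convex : strongly_convex_norm X 3^-1.
Proof.
by move=> l x y; rewrite !kinked_sqrnormE; exact: kinked_sqnorm_strongly_convex.
Qed.

Fact kinked_complete (F : set_system X) : ProperFilter F -> cauchy F -> cvg F.
Proof.
move=> FF F_cauchy.
have fst_cvg : cvg (@kfst R n @ F).
  by apply: cvg_fmap_nonexpansive F_cauchy _ => x y; rewrite -linearB kfst_le.
have snd_cvg : cvg (@ksnd R n @ F).
  by apply: cvg_fmap_nonexpansive F_cauchy _ => x y; rewrite -linearB ksnd_le.
pose l : X := (lim (@kfst R n @ F), lim (@ksnd R n @ F)).
apply/cvg_ex; exists l; apply/cvgrPdist_le => e e0.
have e4 : 0 < e / 4 by rewrite divr_gt0.
move/cvgrPdist_le: fst_cvg => /(_ _ e4) fst_near.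
move/cvgrPdist_le: snd_cvg => /(_ _ e4) snd_near.
near=> x; apply: le_trans (kinked_norm_le _) _.
have fst_le : `|kfst (l - x)| <= e / 4 by rewrite linearB; near: x.
have snd_le : `|ksnd (l - x)| <= e / 4 by rewrite linearB; near: x.
lra.
Unshelve. all: by end_near.
Qed.

HB.instance Definition _ := Uniform_isComplete.Build X kinked_complete.

Lemma dim_kinked_sum : \dim {: X} = (n + n)%N.
Proof. by rewrite dimvf; congr addn; exact: mul1n. Qed.

End kinked_sum_space.

Section kinked_sum_dot.
Variables (R : realType) (n : nat).
Implicit Types x y : kinked_sum R n.

Definition kinked_dot x y : R :=
  \sum_i l2coord i (kfst x) * l2coord i (kfst y)
  + \sum_i l2coord i (ksnd x) * l2coord i (ksnd y).

Fact kinked_dot_bilinear : bilinear_for *%R (idfun \; *%R) kinked_dot.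
Proof.
split=> u k x y; rewrite /kinked_dot /= mulrDr !mulr_sumr [RHS]addrACA;
  rewrite -!big_split; apply: eq_bigr => i _ /=;
  rewrite !linearP /kfst /ksnd /=; ring.
Qed.
HB.instance Definition _ := @bilinear_isBilinear.Build R (kinked_sum R n)
  (kinked_sum R n) R *%R (idfun \; *%R) kinked_dot kinked_dot_bilinear.

Fact kinked_dot_sym x y :
  kinked_dot x y = (-1) ^+ false * idfun (kinked_dot y x).
Proof.
by rewrite expr0 mul1r; congr (_ + _); apply: eq_bigr => i _; rewrite mulrC.
Qed.
HB.instance Definition _ := @isHermitianSesquilinear.Build R (kinked_sum R n)
  false idfun kinked_dot kinked_dot_sym.

Lemma kinked_dotE x : kinked_dot x x = eucl_sqnorm x.
Proof. by rewrite /eucl_sqnorm !l2_sqrnormE. Qed.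

Fact kinked_dot_gt0 x : x != 0 -> 0 < kinked_dot x x.
Proof.
rewrite kinked_dotE lt_def eucl_sqnorm_ge0 andbT.
by apply: contra_neq => /eucl_sqnorm_eq0.
Qed.
HB.instance Definition _ :=
  @isDotProduct.Build R (kinked_sum R n) kinked_dot kinked_dot_gt0.

End kinked_sum_dot.

(** * The two Euclidean summands *)

Section kinked_sum_summands.
Variables (R : realType) (n : nat).
Local Notation X := (kinked_sum R n).
Implicit Types x : X.

Definition first_summand : {vspace X} := lker (linfun (@ksnd R n)).
Definition second_summand : {vspace X} := lker (linfun (@kfst R n)).

Lemma mem_first_summand x : (x \in first_summand) = (ksnd x == 0).
Proof. by rewrite memv_ker lfunE. Qed.

Lemma mem_second_summand x : (x \in second_summand) = (kfst x == 0).
Proof. by rewrite memv_ker lfunE. Qed.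

Lemma dim_first_summand : \dim first_summand = n.
Proof.
have ksnd_surj b : exists x : X, ksnd x = b by exists (0, b).
by have := dim_lker_surj ksnd_surj; rewrite dim_l2 dim_kinked_sum; exact: addIn.
Qed.

Lemma dim_second_summand : \dim second_summand = n.
Proof.
have kfst_surj a : exists x : X, kfst x = a by exists (a, 0).
by have := dim_lker_surj kfst_surj; rewrite dim_l2 dim_kinked_sum; exact: addIn.
Qed.

Lemma cap_summands : (first_summand :&: second_summand = 0)%VS.
Proof.
apply/eqP; rewrite -subv0; apply/subvP => x.
rewrite memv_cap mem_first_summand mem_second_summand memv0.
by case: x => a b /andP[/eqP /= b0 /eqP /= a0]; apply/eqP; congr (_, _).
Qed.

Lemma kinked_sum_split x :
  [/\ ((kfst x, 0) : X) \in first_summand, ((0, ksnd x) : X) \in second_summand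
    & x = (kfst x, 0) + (0, ksnd x)].
Proof.
rewrite mem_first_summand mem_second_summand !eqxx; split=> //.
by case: x => a b; congr (_, _); rewrite /= ?addr0 ?add0r.
Qed.

Lemma add_summands : (first_summand + second_summand = fullv)%VS.
Proof.
apply/eqP; rewrite eqEsubv subvf/=; apply/subvP => x _.
by have [x1 x2 ->] := kinked_sum_split x; exact: memv_add.
Qed.

Lemma daddv_pi_first x : daddv_pi first_summand second_summand x = (kfst x, 0).
Proof.
have [x1 x2 {1}->] := kinked_sum_split x; exact: daddv_piD cap_summands x1 x2.
Qed.

Lemma daddv_pi_second x : daddv_pi second_summand first_summand x = (0, ksnd x).
Proof.
have [x1 x2 {1}->] := kinked_sum_split x; rewrite addrC.
by apply: daddv_piD x2 x1; rewrite capvC cap_summands.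
Qed.

Lemma first_summand_sqrnormE x :
  x \in first_summand -> `|x| ^+ 2 = eucl_sqnorm x.
Proof.
rewrite mem_first_summand => /eqP x2.
by rewrite kinked_sqrnormE /kinked_sqnorm kinked_cross0r ?addr0.
Qed.

Lemma second_summand_sqrnormE x :
  x \in second_summand -> `|x| ^+ 2 = eucl_sqnorm x.
Proof.
rewrite mem_second_summand => /eqP x1.
by rewrite kinked_sqrnormE /kinked_sqnorm kinked_cross0l ?addr0.
Qed.

Lemma first_summand_norm x : x \in first_summand -> `|x| = `|kfst x|.
Proof.
move=> x1; apply/eqP; rewrite -(@eqrXn2 _ 2)// first_summand_sqrnormE//.
move: x1; rewrite mem_first_summand /eucl_sqnorm => /eqP ->.
by rewrite normr0 expr0n addr0.
Qed.

Lemma second_summand_norm x : x \in second_summand -> `|x| = `|ksnd x|.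
Proof.
move=> x2; rewrite -kswap_norm first_summand_norm//.
by move: x2; rewrite mem_first_summand mem_second_summand.
Qed.

Lemma euclidean_first_summand : euclidean_subspace first_summand.
Proof.
apply: (@euclidean_subspace_dot _ _ (@kinked_dot R n)) => x x1.
by rewrite first_summand_sqrnormE// [RHS]kinked_dotE.
Qed.

Lemma euclidean_second_summand : euclidean_subspace second_summand.
Proof.
apply: (@euclidean_subspace_dot _ _ (@kinked_dot R n)) => x x2.
by rewrite second_summand_sqrnormE// [RHS]kinked_dotE.
Qed.

Lemma opnorm_daddv_pi_first : (0 < n)%N ->
  opnorm (daddv_pi first_summand second_summand) = 1%E.
Proof.
move=> n0; pose e : X := (l2basis R (Ordinal n0), 0).
have [e1 _ _] := kinked_sum_split e.
apply: (@opnorm_eq1 _ _ _ _ e) => [x||].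
- have [x1 _ _] := kinked_sum_split x.
  by rewrite daddv_pi_first (first_summand_norm x1); exact: kfst_le x.
- by rewrite (first_summand_norm e1) l2basis_norm.
- by rewrite daddv_pi_first (first_summand_norm e1) l2basis_norm.
Qed.

Lemma opnorm_daddv_pi_second : (0 < n)%N ->
  opnorm (daddv_pi second_summand first_summand) = 1%E.
Proof.
move=> n0; pose e : X := (0, l2basis R (Ordinal n0)).
have [_ e2 _] := kinked_sum_split e.
apply: (@opnorm_eq1 _ _ _ _ e) => [x||].
- have [_ x2 _] := kinked_sum_split x.
  by rewrite daddv_pi_second (second_summand_norm x2); exact: ksnd_le x.
- by rewrite (second_summand_norm e2) l2basis_norm.
- by rewrite daddv_pi_second (second_summand_norm e2) l2basis_norm.
Qed.

End kinked_sum_summands.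

(** * Kinks of the norm and near-isometries *)

Section kinks.
Variables (R : realType) (n : nat).
Implicit Types (x y : kinked_sum R n) (i j : 'I_n).

Lemma kinked_second_difference_ge x y i j :
  n%:R^-1 * (`|l2coord i (kfst (x + y))| * `|l2coord j (ksnd (x + y))|
    + `|l2coord i (kfst (x - y))| * `|l2coord j (ksnd (x - y))|
    - 2 * (`|l2coord i (kfst x)| * `|l2coord j (ksnd x)|)) <=
  sqnorm_second_difference x y.
Proof.
pose m (z : kinked_sum R n) k l :=
  `|l2coord k (kfst z)| * `|l2coord l (ksnd z)|.
pose D k l := m (x + y) k l + m (x - y) k l - 2 * m x k l.
have D_ge k l : 0 <= D k l + 2 * m y k l.
  rewrite /D /m !linearB !linearD -lerBlDr sub0r.
  exact: normrM_second_difference.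
have D_le_sum : D i j <= \sum_k \sum_l (D k l + 2 * m y k l).
  rewrite (bigD1 i)//= (bigD1 j)//= -2!addrA lerDl.
  by rewrite !addr_ge0 ?sumr_ge0// => [|k _]; rewrite ?sumr_ge0// /m !mulr_ge0.
have cross_sum : n%:R^-1 * \sum_k \sum_l (D k l + 2 * m y k l) =
    kinked_cross (x + y) + kinked_cross (x - y) - 2 * kinked_cross x
    + 2 * kinked_cross y.
  rewrite /kinked_cross !(mulrCA 2 n%:R^-1) -mulrDr -mulrBr -mulrDr.
  congr (_ * _); rewrite !mulr_sumr -big_split -sumrB -big_split.
  apply: eq_bigr => k _.
  by rewrite /= !mulr_sumr -big_split -sumrB -big_split.
have nV0 : 0 <= n%:R^-1 :> R by rewrite invr_ge0.
apply: le_trans (ler_wpM2l nV0 D_le_sum) _.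
rewrite cross_sum /sqnorm_second_difference !kinked_sqrnormE /kinked_sqnorm.
have := eucl_sqnorm_parallelogram x y; have := eucl_sqnorm_ge0 y.
have := kinked_cross_le y; lra.
Qed.

Lemma kinked_kink x y i j :
  n%:R^-1 * ((2 * `|l2coord i (kfst y)| - 4 * `|l2coord i (kfst x)|)
    * `|l2coord j (ksnd x)|) <= sqnorm_second_difference x y.
Proof.
apply: le_trans (kinked_second_difference_ge x y i j).
rewrite ler_wpM2l ?invr_ge0// !linearB !linearD mulrBl -!mulrA.
exact: normrM_kink.
Qed.

End kinks.

Section near_isometry_kinks.
Variables (R : realType) (m n : nat).
Implicit Types (L : {linear l2 R m -> kinked_sum R n}) (v e : l2 R m).
Implicit Types (i j : 'I_n) (d t : R).

Lemma near_isometry_kink_fst d L v e t i j :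
  near_isometry d L -> 0 <= t -> `|v| = 1 -> `|e| = 1 ->
  n%:R^-1 * ((2 * (t * `|l2coord i (kfst (L e))|)
    - 4 * `|l2coord i (kfst (L v))|) * `|l2coord j (ksnd (L v))|) <=
  2 * (1 + d) * t ^+ 2 + 4 * d.
Proof.
move=> Ld t0 v1 e1; have := near_isometry_second_difference v (t *: e) Ld.
rewrite normrZ v1 e1 expr1n !mulr1 real_normK ?num_real//; apply: le_trans.
apply: le_trans (kinked_kink _ _ i j).
by rewrite !linearZ/= normrM (ger0_norm t0).
Qed.

Lemma near_isometry_kink_snd d L v e t i j :
  near_isometry d L -> 0 <= t -> `|v| = 1 -> `|e| = 1 ->
  n%:R^-1 * ((2 * (t * `|l2coord j (ksnd (L e))|)
    - 4 * `|l2coord j (ksnd (L v))|) * `|l2coord i (kfst (L v))|) <=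
  2 * (1 + d) * t ^+ 2 + 4 * d.
Proof.
move=> Ld t0 v1 e1.
apply: (near_isometry_kink_fst (L := @kswap R n \o L)) => // w /=.
by rewrite kswap_norm; exact: Ld.
Qed.

End near_isometry_kinks.

(* Otherwise both components of [L e] have a large coordinate, a_i and b_j say.
   At a unit vector [v] with a_i (L v) = 0, the kink of |a_i| makes all the
   b_k (L v) small, so that some a_k (L v) is large. The kink of |b_j| at [L v]
   then makes b_j (L e) small. *)
Lemma near_isometry_fst_norm_neq (R : realType) (m : nat)
    (L : {linear l2 R m -> kinked_sum R 2}) (e : l2 R m) :
  (1 < m)%N -> near_isometry (10 ^- 8) L -> `|e| = 1 ->
  `|kfst (L e)| <> 1 / 2.
Proof.
move=> m_gt1 Ld e1 fst_half.
have norm_lb v : `|v| = 1 ->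
    2 / 3 * (1 - 10 ^- 8) <= `|kfst (L v)| ^+ 2 + `|ksnd (L v)| ^+ 2.
  move=> v1; have := Ld v; have := eucl_sqnorm_ge (L v).
  rewrite /eucl_sqnorm v1 expr1n ler_norml => ? /andP[? _]; lra.
have [i ai] : exists i, 1 / 3 <= `|l2coord i (kfst (L e))|.
  have [i i_max] := l2coord_max (kfst (L e)) (isT : 0 < 2)%N.
  by exists i; apply: normr_ge_sqr; move: i_max; rewrite ?fst_half; lra.
have [j bj] : exists j, 2 / 5 <= `|l2coord j (ksnd (L e))|.
  have [j j_max] := l2coord_max (ksnd (L e)) (isT : 0 < 2)%N.
  exists j; apply: normr_ge_sqr; first lra.
  by have := norm_lb e e1; rewrite fst_half; lra.
have [v v1 av] : exists2 v, `|v| = 1 & l2coord i (kfst (L v)) = 0.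
  by apply: (exists_unit_ker (l2coord i \o @kfst R 2 \o L)); rewrite dim_l2.
have b_small k : `|l2coord k (ksnd (L v))| <= 1 / 300.
  have t0 : 0 <= 1 / 3000 :> R by lra.
  have := near_isometry_kink_fst i k Ld t0 v1 e1; rewrite av normr0.
  have := ler_wpM2r (normr_ge0 (l2coord k (ksnd (L v)))) ai; lra.
have [k ak] : exists k, 1 / 2 <= `|l2coord k (kfst (L v))|.
  have [k k_max] := l2coord_max (kfst (L v)) (isT : 0 < 2)%N.
  have [l l_max] := l2coord_max (ksnd (L v)) (isT : 0 < 2)%N.
  exists k; apply: normr_ge_sqr; first lra.
  have := ler_pM (normr_ge0 _) (normr_ge0 _) (b_small l) (b_small l).
  by rewrite -expr2 real_normK ?num_real//; have := norm_lb v v1; lra.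
have t0 : 0 <= 1 / 20 :> R by lra.
have := near_isometry_kink_snd k j Ld t0 v1 e1.
have := b_small j; nra.
Qed.

Lemma bilipschitz_near_isometry (R : realType) (m : nat) (X : normedModType R)
    (c K eta : R) (T : l2 R m -> X) :
  0 < c -> strongly_convex_norm X c -> 0 < K -> 0 <= eta ->
  K ^+ 2 - K ^- 2 <= 4 * c * eta ^+ 2 ->
  K - 1 + (4 * m%:R + 9) * m%:R * eta <= 1 ->
  T 0 = 0 -> bilipschitz K T ->
  near_isometry (3 * (K - 1 + (4 * m%:R + 9) * m%:R * eta))
    (l2_lincomb (T \o @l2basis R m)).
Proof.
move=> c0 convX K0 eta0 K_eta K_small T0 TK.
apply: (near_isometry_approx K0 K_small T0 TK) => v v1.
apply: (approx_affine_lincomb eta0 T0) => //.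
exact: bilipschitz_approx_affine c0 convX K0 eta0 K_eta TK.
Qed.

(** * Absence of bendings *)

Lemma bilipschitz_fst_norm_neq (R : realType) (T : l2 R 2 -> kinked_sum R 2)
    (i : 'I_2) :
  bilipschitz (1 + 10 ^- 23) T -> T 0 = 0 -> `|kfst (T (l2basis R i))| <> 1 / 2.
Proof.
move=> TK T0; rewrite -[T _](l2_lincomb_basis (T \o @l2basis R 2)).
have [c0 eps0] : 0 < 3^-1 :> R /\ 0 < 10 ^- 23 :> R.
  by rewrite !invr_gt0 exprn_gt0.
have eta0 : 0 <= 10 ^- 11 :> R by rewrite invr_ge0 exprn_ge0.
have K0 : 0 < 1 + 10 ^- 23 :> R by rewrite addr_gt0.
have K_eta : (1 + 10 ^- 23) ^+ 2 - (1 + 10 ^- 23) ^- 2 <=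
    4 * 3^-1 * (10 ^- 11) ^+ 2 :> R.
  have : 1 - 2 * 10 ^- 23 <= (1 + 10 ^- 23) ^- 2 :> R.
    by rewrite -[leRHS]mul1r ler_pdivlMr ?exprn_gt0//; nra.
  lra.
have K_small : 1 + 10 ^- 23 - 1 + (4 * 2%:R + 9) * 2%:R * 10 ^- 11 <= 1 :> R.
  lra.
have L_near := bilipschitz_near_isometry c0 (@kinked_strongly_convex R 2) K0
  eta0 K_eta K_small T0 TK.
apply: near_isometry_fst_norm_neq => [//|v|]; last exact: l2basis_norm.
by apply: le_trans (L_near v) _; rewrite ler_wpM2r ?sqr_ge0//; lra.
Qed.

Lemma bending_balanced_scale (R : realType) (m n : nat) (C r rho : R)
    (I1 I2 : {linear l2 R m -> kinked_sum R n}) (T : l2 R m -> kinked_sum R n)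
    (e : l2 R m) :
  0 < r -> r < rho -> `|e| = 1 -> isometric_embedding I1 ->
  (forall y, I1 y \in first_summand R n) ->
  (forall y, I2 y \in second_summand R n) ->
  bilipschitz C T -> bending C r rho I1 I2 T ->
  exists2 s, 0 < s & `|kfst (T (s *: e))| = s / 2.
Proof.
move=> r0 r_rho e1 iso1 I1_first I2_second TC [_ T1 T2].
pose f s := `|kfst (T (s *: e))| - s / 2.
have norm_scale s : 0 < s -> `|s *: e| = s.
  by move=> s0; rewrite normrZ e1 mulr1 gtr0_norm.
have f_cont : continuous f.
  apply: (@klipschitz_continuous _ _ _ (C + 1 / 2)) => s s'.
  have -> : f s - f s' =
      `|kfst (T (s *: e))| - `|kfst (T (s' *: e))| - (s - s') / 2.
    by rewrite /f; field.
  apply: le_trans (ler_normB _ _) _; rewrite [leRHS]mulrDl lerD//; last first.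
    by rewrite normrM [`|2^-1|]gtr0_norm// mulrC mul1r.
  apply: le_trans (ler_dist_dist _ _) _; rewrite -linearB.
  apply: le_trans (kfst_le _) _; have /andP[_] := TC (s *: e) (s' *: e).
  by rewrite -scalerBl normrZ e1 mulr1.
have fr : f r = r / 2.
  rewrite /f T1 ?norm_scale// -first_summand_norm ?I1_first// iso1 norm_scale//.
  by field.
have rho0 : 0 < rho by apply: lt_trans r_rho.
have frho : f rho = - (rho / 2).
  rewrite /f T2 ?norm_scale//; have := I2_second (rho *: e).
  by rewrite mem_second_summand => /eqP ->; rewrite normr0 sub0r.
have [|s] := @IVT R f r rho 0 (ltW r_rho) (continuous_subspaceT f_cont).
  rewrite fr frho ge_min le_max; apply/andP.
  by split; apply/orP; [right|left]; lra.
rewrite in_itv /= => /andP[rs _] fs; exists s; first exact: lt_le_trans rs.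
by move: fs; rewrite /f; lra.
Qed.

Lemma bending_bilipschitz (R : realType) (Y X : completeNormedModType R)
    (C r rho : R) (I1 I2 : {linear Y -> X}) (T : Y -> X) (e : Y) :
  0 < C -> 0 < r -> `|e| = 1 -> isometric_embedding I1 ->
  bending C r rho I1 I2 T -> bilipschitz C T /\ T 0 = 0.
Proof.
move=> C0 r0 e1 iso1 [T_distortion T1 _].
have T0 : T 0 = 0 by rewrite T1 ?linear0// normr0 ltW.
have re_norm : `|r *: e| = r by rewrite normrZ e1 mulr1 gtr0_norm.
split=> //; apply: (@distortion_le_bilipschitz _ _ _ _ _ (r *: e) 0) => //.
  by rewrite -normr_gt0 re_norm.
by rewrite T0 !subr0 T1 ?re_norm// iso1.
Qed.

Lemma no_bending (R : realType) (r rho : R)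
    (I1 I2 : {linear l2 R 2 -> kinked_sum R 2}) (T : l2 R 2 -> kinked_sum R 2) :
  0 < r -> r < rho -> isometric_embedding I1 ->
  (forall y, I1 y \in first_summand R 2) ->
  (forall y, I2 y \in second_summand R 2) ->
  ~ bending (1 + 10 ^- 23) r rho I1 I2 T.
Proof.
move=> r0 r_rho iso1 I1_first I2_second T_bending.
have e1 := @l2basis_norm R 2 ord0.
have C0 : 0 < 1 + 10 ^- 23 :> R by rewrite addr_gt0 ?invr_gt0 ?exprn_gt0.
have [TC T0] := bending_bilipschitz C0 r0 e1 iso1 T_bending.
have [s s0 fst_half] := bending_balanced_scale r0 r_rho e1 iso1
  I1_first I2_second TC T_bending.
apply: (bilipschitz_fst_norm_neq (i := ord0) (bilipschitz_rescale s0 TC)).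
  by rewrite scaler0 T0 scaler0.
by rewrite linearZ normrZ fst_half gtr0_norm ?invr_gt0//; field; rewrite gt_eqF.
Qed.

Theorem theorem5p1 (R : realType) :
  exists (X : finBanachType R) (Y1 Y2 : {vspace X}),
    [/\ \dim {:X} = 4%N,
      [/\ (Y1 + Y2)%VS = fullv, directv (Y1 + Y2),
        \dim Y1 = 2%N & \dim Y2 = 2%N],
      euclidean_subspace Y1 /\ euclidean_subspace Y2,
      opnorm (daddv_pi Y1 Y2) = 1%E /\ opnorm (daddv_pi Y2 Y1) = 1%E
      & exists2 eps : R, 0 < eps &
        forall r rho : R, 0 < r -> r < rho ->
        forall I1 I2 : {linear l2 R 2 -> X},
          isometric_embedding I1 -> isometric_embedding I2 ->
          (forall y, I1 y \in Y1) -> (forall y, I2 y \in Y2) ->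
          ~ exists T : l2 R 2 -> X, bending (1 + eps) r rho I1 I2 T].
Proof.
exists (kinked_sum R 2 : finBanachType R).
exists (first_summand R 2), (second_summand R 2); split.
- exact: dim_kinked_sum.
- split; first exact: add_summands.
  + exact/directv_addP/cap_summands.
  + exact: dim_first_summand.
  + exact: dim_second_summand.
- by split; [exact: euclidean_first_summand|exact: euclidean_second_summand].
- by split; [exact: opnorm_daddv_pi_first|exact: opnorm_daddv_pi_second].
exists (10 ^- 23); first by rewrite invr_gt0 exprn_gt0.
move=> r rho r0 r_rho I1 I2 iso1 _ I1_first I2_second [T].
exact: no_bending r0 r_rho iso1 I1_first I2_second.
Qed.
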